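(* Assume that for some $\eta>0$, $\mathrm{supp}\,(\mu)\supset\{z\in\mathbb{R}^n:\ |z|\le\eta\}$. Let $u_0\in C(\Omega)$ be nonnegative, not identically zero and compactly supported in $\Omega$. For $\varepsilon>0$ let $u_\varepsilon\in C(\bar\Omega\times[0,\infty))$ be the unique classical solution of $$\begin{cases}\partial_t u_\varepsilon-\varepsilon\Delta u_\varepsilon=K_0(u_\varepsilon)&\text{in }\Omega\times(0,\infty),\\ u_\varepsilon(x,t)=0&\text{on }\partial\Omega\times(0,\infty),\\ u_\varepsilon(x,0)=u_0(x)&\text{in }\Omega.\end{cases}$$ Then the limit of $u_\varepsilon$ as $\varepsilon\to0$ (pointwise in $\Omega\times(0,\infty)$), extended continuously to a function $u\in C(\bar\Omega\times[0,\infty))$, is strictly positive on the boundary: $u(x,t)>0$ for all $x\in\partial\Omega$ and all $t>0$. (Hence, although $u_\varepsilon=0$ on $\partial\Omega\times(0,\infty)$ for every $\varepsilon>0$, the limit $u$ does not take the zero boundary data on $\partial\Omega$ at any time $t>0$.)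
   Context: $\Omega\subset\mathbb{R}^n$ is open, bounded, connected and regular (i.e. with smooth boundary). $\mu\in L^1(\mathbb{R}^n)$ is a nonnegative function with $\int_{\mathbb{R}^n}\mu(z)\,dz=1$; the symbol $\mu$ also denotes the measure $d\mu(z)=\mu(z)\,dz$, and $\mathrm{supp}\,(\mu)$ is its support as a measure. The nonlocal operator with zero boundary data is $$K_0(u)(x,t)=\int_{\{z:\,x+z\in\Omega\}}u(x+z,t)\,d\mu(z)-u(x,t).$$ For every $\varepsilon>0$ the viscous problem has exactly one classical solution (continuous on $\bar\Omega\times[0,\infty)$, with $\partial_t u_\varepsilon$ and the second-order space derivatives continuous in $\Omega\times(0,\infty)$). As $\varepsilon\to0$, $u_\varepsilon$ converges pointwise in $\Omega\times(0,\infty)$ to the unique $u\in C(\bar\Omega\times[0,\infty))$ satisfying $\partial_t u=K_0(u)$ in $\Omega\times(0,\infty)$ (in the sense of distributions) and $u(\cdot,0)=u_0$ in $\Omega$. *)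

(* Defs.v *)
From HB Require Import structures.
From mathcomp Require Import all_boot all_order all_algebra.
From mathcomp Require Import all_classical all_reals all_analysis.

Set Implicit Arguments.
Unset Strict Implicit.
Unset Printing Implicit Defensive.

Import Order.TTheory GRing.Theory Num.Theory.
Import numFieldNormedType.Exports.

Local Open Scope classical_set_scope.
Local Open Scope ring_scope.

(** * Lebesgue measure on R^n

    R^n is ['rV[R]_n].  Its sigma-algebra is generated by the coordinates,
    hence is the Borel one; its Lebesgue measure is obtained from the library's
    one-dimensional measure by iterated products. *)

Fact measure_rV_display : measure_display.
Proof. exact. Qed.

Section measurable_rV.
Context {R : realType} (n : nat).

Let coor (i : 'I_n) (x : 'rV[R]_n) : R := x ord0 i.

Let rV_set0 : g_sigma_preimage coor set0.
Proof. exact: sigma_algebra0. Qed.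

Let rV_setC A : g_sigma_preimage coor A -> g_sigma_preimage coor (~` A).
Proof. exact: sigma_algebraC. Qed.

Let rV_bigcup (F : (set 'rV[R]_n)^nat) :
  (forall i, g_sigma_preimage coor (F i)) ->
  g_sigma_preimage coor (\bigcup_i F i).
Proof. exact: sigma_algebra_bigcup. Qed.

HB.instance Definition _ := @isMeasurable.Build measure_rV_display
  'rV[R]_n (g_sigma_preimage coor) rV_set0 rV_setC rV_bigcup.

Lemma measurable_rV_coord (i : 'I_n) :
  measurable_fun [set: 'rV[R]_n] (fun x : 'rV[R]_n => x ord0 i).
Proof.
move=> _ Y mY; rewrite setTI; apply: sub_sigma_algebra => /=.
rewrite -bigcup_seq/=; exists i => /=; first by rewrite mem_index_enum.
by exists Y => //; rewrite setTI.
Qed.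

Lemma measurable_fun_rV d (T : measurableType d) (f : T -> 'rV[R]_n) :
  (forall i, measurable_fun [set: T] (fun x => f x ord0 i)) ->
  measurable_fun [set: T] f.
Proof.
move=> mf _ Y mY; rewrite setTI.
apply: (mY [set A | measurable (f @^-1` A)]); split.
  split => /=; first by rewrite preimage_set0.
  - by move=> A mA; rewrite setTD preimage_setC; exact: measurableC.
  - by move=> F mF; rewrite preimage_bigcup; exact: bigcupT_measurable.
move=> A; rewrite -bigcup_seq => -[i _ [B mB <-]] /=.
by rewrite setTI -[X in measurable X]setTI; exact: mf.
Qed.

End measurable_rV.

Section lebesgue_rV.
Context {R : realType}.

Definition cons_rV n (p : measurableTypeR R * 'rV[R]_n) : 'rV[R]_n.+1 :=
  row_mx (p.1%:M : 'rV[R]_1) p.2.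

Definition uncons_rV n (x : 'rV[R]_n.+1) : measurableTypeR R * 'rV[R]_n :=
  (x ord0 ord0 : R, rsubmx (x : 'rV[R]_(1 + n))).

Lemma cons_rVE n (p : measurableTypeR R * 'rV[R]_n) (i : 'I_n.+1) :
  cons_rV p ord0 i = if unlift ord0 i is Some j then p.2 ord0 j else p.1.
Proof.
rewrite /cons_rV; case: unliftP => [j|] ->.
  have -> : lift ord0 j = rshift 1 j :> 'I_(1 + n) by exact/val_inj.
  exact: row_mxEr.
have -> : ord0 = lshift n ord0 :> 'I_(1 + n) by exact/val_inj.
by rewrite [LHS]row_mxEl mxE mulr1n.
Qed.

Lemma cons_rVK n : cancel (@cons_rV n) (@uncons_rV n).
Proof.
move=> [x v]; rewrite /uncons_rV cons_rVE unlift_none /=.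
by rewrite /cons_rV row_mxKr.
Qed.

Lemma measurable_cons_rV n : measurable_fun setT (@cons_rV n).
Proof.
apply: measurable_fun_rV => i; under eq_fun do rewrite cons_rVE.
case: (unlift ord0 i) => [j|]; last exact: measurable_fst.
exact: measurableT_comp (measurable_rV_coord j) measurable_snd.
Qed.

Lemma measurable_uncons_rV n : measurable_fun setT (@uncons_rV n).
Proof.
apply/measurable_fun_pairP; split; first exact: measurable_rV_coord.
apply: measurable_fun_rV => i /=.
under eq_fun do rewrite mxE; exact: measurable_rV_coord.
Qed.

Section step.
Variables (n : nat) (m : {sigma_finite_measure set 'rV[R]_n -> \bar R}).

Let lebesgue_R : {sigma_finite_measure set (measurableTypeR R) -> \bar R} :=
  lebesgue_measure.

Let prod_m : {measure set (measurableTypeR R * 'rV[R]_n)%type -> \bar R} :=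
  (lebesgue_R \x m)%E.

Definition lebesgue_rV_step : set 'rV[R]_n.+1 -> \bar R :=
  pushforward prod_m (@cons_rV n).

Let step0 : lebesgue_rV_step set0 = 0%E.
Proof. by rewrite /lebesgue_rV_step /pushforward preimage_set0 measure0. Qed.

Let step_ge0 A : (0 <= lebesgue_rV_step A)%E.
Proof. exact: (measure_ge0 prod_m). Qed.

Let step_sigma_additive : semi_sigma_additive lebesgue_rV_step.
Proof.
have mc := @measurable_cons_rV n; exact: measure_semi_sigma_additive.
Qed.

HB.instance Definition _ := isMeasure.Build _ _ _ lebesgue_rV_step
  step0 step_ge0 step_sigma_additive.

Let step_sigma_finite : sigma_finite setT lebesgue_rV_step.
Proof.
have /sigma_finiteP[F [FT ndF Foo]] := sigma_finiteT lebesgue_R.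
have /sigma_finiteP[G [GT ndG Goo]] := sigma_finiteT m.
exists (fun k => @uncons_rV n @^-1` (F k `*` G k)).
  rewrite -preimage_bigcup -[LHS](preimage_setT (@uncons_rV n)); congr preimage.
  rewrite -setXTT FT GT predeqE => -[x y]; split.
    move=> [/= [i _ Fx] [j _ Gy]]; exists (maxn i j) => //; split.
      by move: x Fx; exact/subsetPset/ndF/leq_maxl.
    by move: y Gy; exact/subsetPset/ndG/leq_maxr.
  by move=> [i _ []/= ? ?]; split; exists i.
move=> k; have [mF Fk] := Foo k; have [mG Gk] := Goo k; split.
  by rewrite -[X in measurable X]setTI; apply: measurable_uncons_rV => //;
    exact: measurableX.
rewrite /lebesgue_rV_step /pushforward -comp_preimage.
rewrite (_ : _ \o _ = id); last by apply/funext => p /=; exact: cons_rVK.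
rewrite preimage_id [ltLHS](product_measure1E lebesgue_R)//.
by rewrite lte_mul_pinfty// ge0_fin_numE.
Qed.

HB.instance Definition _ := @Measure_isSigmaFinite.Build _ _ _
  lebesgue_rV_step step_sigma_finite.

End step.

Fixpoint lebesgue_rV n : {sigma_finite_measure set 'rV[R]_n -> \bar R} :=
  if n is n'.+1 then lebesgue_rV_step (lebesgue_rV n') else \d_(0 : 'rV[R]_0).

Lemma measurable_box n (a b : 'I_n -> R) :
  measurable [set x : 'rV[R]_n | forall i, a i <= x ord0 i <= b i].
Proof.
rewrite (_ : mkset _ = \bigcap_(i in [set: 'I_n])
    ((fun x : 'rV[R]_n => x ord0 i) @^-1` `[a i, b i])); last first.
  by apply/seteqP; split => [x xab i _|x xab i]; [|have := xab i I];
    rewrite /= in_itv /=.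
apply: fin_bigcap_measurable => // i _.
by rewrite -[X in measurable X]setTI; exact: measurable_rV_coord.
Qed.

Lemma lebesgue_rV_box n (a b : 'I_n -> R) : (forall i, a i <= b i) ->
  lebesgue_rV n [set x | forall i, a i <= x ord0 i <= b i] =
  (\prod_(i < n) (b i - a i))%:E.
Proof.
elim: n a b => [|n IH] a b ab.
  by rewrite big_ord0 /= diracE mem_set// => -[].
rewrite big_ord_recl EFinM /= /lebesgue_rV_step /pushforward.
set a' := fun j => a (lift ord0 j); set b' := fun j => b (lift ord0 j).
have -> : @cons_rV n @^-1` [set x | forall i, a i <= x ord0 i <= b i] =
    (`[a ord0, b ord0] : set (measurableTypeR R)) `*`
    [set x : 'rV[R]_n | forall i, a' i <= x ord0 i <= b' i].
  apply/seteqP; split => -[x v] /=.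
    move=> xv; split; first by have := xv ord0; rewrite cons_rVE unlift_none.
    by move=> i; have := xv (lift ord0 i); rewrite cons_rVE liftK.
  move=> [x0 vi] i; rewrite cons_rVE.
  by case: unliftP => [j|] ->; [exact: vi|move: x0; rewrite in_itv].
rewrite [LHS]product_measure1E//=; last exact: measurable_box.
rewrite -IH; last by move=> i; exact: ab.
congr (_ * _)%E; rewrite lebesgue_measure_itv /= lte_fin -EFinD.
by case: ltgtP (ab ord0) => // ->; rewrite subrr.
Qed.

End lebesgue_rV.
Arguments lebesgue_rV : clear implicits.

(** * Calculus on R^n *)

Section euclidean.
Context {R : realType} {n : nat}.
Implicit Types (f : 'rV[R]_n -> R) (Omega U : set 'rV[R]_n) (x z : 'rV[R]_n).

(* the library's norm on ['rV[R]_n] is the sup norm *)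
Definition enorm z : R := Num.sqrt (\sum_(i < n) z ord0 i ^+ 2).

Definition basis (i : 'I_n) : 'rV[R]_n := delta_mx ord0 i.

Definition dpart (i : 'I_n) f : 'rV[R]_n -> R := fun x => 'D_(basis i) f x.

Definition laplacian f x : R := \sum_(i < n) dpart i (dpart i f) x.

(* C^infinity on the open set U: partial derivatives of all orders exist and
   are continuous at every point of U *)
Definition smooth_on U f := forall (s : seq 'I_n) x, U x ->
  {for x, continuous (foldr dpart f s)} /\
  forall i, derivable (foldr dpart f s) x (basis i).

Definition boundary Omega : set 'rV[R]_n := closure Omega `\` interior Omega.

(* near each boundary point, Omega is the negativity set of a smooth function
   with nonzero gradient there *)
Definition smooth_boundary Omega := forall p, boundary Omega p ->
  exists (U : set 'rV[R]_n) (rho : 'rV[R]_n -> R),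
    [/\ open U, U p, smooth_on U rho, exists i, dpart i rho p != 0 &
        Omega `&` U = [set x | U x /\ rho x < 0]].

End euclidean.

(** * The nonlocal problem *)

Section nonlocal.
Context {R : realType} {n : nat}.
Implicit Types (Omega : set 'rV[R]_n) (mu : 'rV[R]_n -> R).
Implicit Types (u : 'rV[R]_n -> R -> R).

Definition density_measure mu (A : set 'rV[R]_n) : \bar R :=
  (\int[lebesgue_rV R n]_(z in A) (mu z)%:E)%E.

Definition measure_support (m : set 'rV[R]_n -> \bar R) : set 'rV[R]_n :=
  [set z | forall U, open U -> U z -> (0 < m U)%E].

Definition K0 Omega mu u (x : 'rV[R]_n) (t : R) : R :=
  \int[lebesgue_rV R n]_(z in [set z | Omega (x + z)]) (u (x + z) t * mu z)
  - u x t.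

(* u is in C(closure Omega x [0, oo)); values elsewhere are irrelevant *)
Definition continuous_cylinder Omega u :=
  {within closure Omega `*` [set t : R | 0 <= t],
    continuous (fun p : 'rV[R]_n * R => u p.1 p.2)}.

(* du/dt and all second-order space derivatives of u exist and are continuous
   on Omega x (0, oo) *)
Definition regular_cylinder Omega u := forall x t, Omega x -> 0 < t ->
  [/\ derivable (u x) t 1,
      {for (x, t), continuous (fun p : 'rV[R]_n * R => derive1 (u p.1) p.2)} &
      forall i j,
      [/\ derivable (u ^~ t) x (basis i),
          derivable (dpart i (u ^~ t)) x (basis j) &
          {for (x, t), continuous
            (fun p : 'rV[R]_n * R => dpart j (dpart i (u ^~ p.2)) p.1)}]].

Definition viscous_solution Omega mu (u0 : 'rV[R]_n -> R) (eps : R) u :=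
  [/\ continuous_cylinder Omega u,
      regular_cylinder Omega u,
      forall x t, Omega x -> 0 < t ->
        derive1 (u x) t - eps * laplacian (u ^~ t) x = K0 Omega mu u x t,
      forall x t, boundary Omega x -> 0 < t -> u x t = 0 &
      forall x, Omega x -> u x 0 = u0 x].

End nonlocal.

(* Main.v *)
Require Import Defs.
From HB Require Import structures.
From mathcomp Require Import all_boot all_order all_algebra.
From mathcomp Require Import all_classical all_reals all_analysis.
From mathcomp Require Import ring lra.

Set Implicit Arguments.
Unset Strict Implicit.
Unset Printing Implicit Defensive.

Import Order.TTheory GRing.Theory Num.Theory.
Import numFieldNormedType.Exports.

Local Open Scope classical_set_scope.
Local Open Scope ring_scope.

(** Lower bounds are proved for the viscous solutions [u_ eps], uniformly as [eps]
    tends to 0, so that no equation has to be derived for the limit: the pointwise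
    convergence merely transports the bounds to [u].

    Writing the equation as u_t - eps Delta u + u = g, where
    g(x,t) = int u(x+z,t) mu(z) dz is the nonlocal term, a first minimum principle
    ([viscous_ge0]) gives u >= 0, hence g >= 0.  A second one, local, compares u
    in a cube of half-side r around x with the explicit barrier
    exp(s0-s) [(al + ga (s-s0)) (1 - |y-x|^2/r^2) - L (s-s0)], where al bounds u
    from below at time s0 and ga bounds g from below afterwards
    ([viscous_center_lower_bound]).  Here L is of order eps/r^2, so for small eps,
    depending on r, the value at the center x is at least
    exp(-T) (al + ga (s-s0))/2, an amount which does not depend on r
    ([viscous_center_uniform_bound]).

    With ga = 0 this makes a point where u_0 > 0 uniformly positive: near it,
    [u_ eps] is bounded below by a positive constant for all small eps on any time
    interval [s0, T] with s0 > 0.  If p is such a point and p - x lies in the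
    support of mu, then g is bounded below near x, and the case al = 0 yields a
    lower bound for [u_ eps] near x ([uniformly_positive_spread]).  The uniformly
    positive points thus form an open, relatively closed, nonempty subset of the
    connected set Omega: they are all of Omega.

    The independence of r is what reaches the boundary.  For x on the boundary,
    take p in Omega close to x; the spreading lemma bounds [u_ eps] below by the
    same constant c at every point y of Omega near x, although the threshold
    on eps degenerates as y approaches the boundary.  Letting eps tend to 0 first
    and then y to x gives u(x,t) >= c > 0. *)

(** * Derivative tests for functions touched from below *)
Section touching.
Context {R : realType}.

Lemma dnbhs0_ball (P : set R) : 0^' P ->
  exists2 e, 0 < e & forall h, h != 0 -> `|h| < e -> P h.
Proof.
move=> /nbhs_ballP[e /= e0 He]; exists e => // h h0 he; apply: He => //.
by rewrite /ball /= sub0r normrN.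
Qed.

(** A function touched from below at [t] by [g] along its past cannot grow faster
    than [g]; only times before [t] are compared because the minimum of a
    parabolic problem may sit at the final time. *)
Lemma derive1_le_of_touch_left (f g : R -> R) (t dg d : R) : 0 < d ->
  derivable f t 1 -> is_derive t 1 g dg -> f t = g t ->
  (forall s, t - d < s -> s < t -> g s <= f s) -> derive1 f t <= dg.
Proof.
move=> d0 df gdg fgt gf; have dgt : derivable g t 1 by [].
have dgE : 'D_1 g t = dg by exact: derive_val.
rewrite derive1E leNgt; apply/negP => dlt.
have : 0 < 'D_1 (f - g) t by rewrite deriveB// dgE subr_gt0.
move=> p0; have [e e0 He] := dnbhs0_ball (cvgr_gt _ (derivableB df dgt) _ p0).
pose h := - (Num.min e d / 2).
have m0 : 0 < Num.min e d by rewrite lt_min e0.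
have me : Num.min e d <= e by rewrite ge_min lexx.
have md : Num.min e d <= d by rewrite ge_min lexx orbT.
have h0 : h < 0 by rewrite /h; lra.
have he : `|h| < e by rewrite ltr0_norm// /h; lra.
have hN0 : h != 0 by rewrite lt_eqF.
have := He h hN0 he; have -> : (f - g) t = 0 by rewrite fctE fgt subrr.
rewrite subr0 /GRing.scale /= mulr1.
rewrite nmulr_rgt0 ?invr_lt0//; apply/negP; rewrite -leNgt subr_ge0.
by apply: gf; rewrite /h; lra.
Qed.

(** If [ddf < 0], then [df] would be negative just to the right of its zero, and
    [f] would decrease there.  The derivative is passed as a function [df] because
    it is identified only near the minimum. *)
Lemma second_derivative_at_min (f df : R -> R) (ddf d : R) : 0 < d ->
  (forall s : R, `|s| < d -> is_derive s 1 f (df s)) -> is_derive (0 : R) 1 df ddf ->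
  (forall s : R, `|s| < d -> f 0 <= f s) -> 0 <= ddf.
Proof.
move=> d0 fdf dfddf fmin; rewrite leNgt; apply/negP => dlt.
have f'0 : df 0 = 0.
  have f0 : is_derive (0 : R) 1 f (df 0) by apply: fdf; rewrite normr0.
  rewrite -(@derive_val _ _ _ _ _ _ _ f0).
  apply: (@derive_val _ _ _ _ _ _ 0); apply: (@derive1_at_min _ f (- d) d).
  - lra.
  - by move=> s; rewrite in_itv/= -ltr_norml => /fdf[].
  - by rewrite in_itv/= oppr_lt0 d0.
  - by move=> s; rewrite in_itv/= -ltr_norml; exact: fmin.
have ddf0 : derivable df 0 1 by [].
have dlt' : 'D_1 df 0 < 0 by rewrite derive_val.
have [e e0 He] := dnbhs0_ball (cvgr_lt _ ddf0 _ dlt').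
pose m := Num.min e d.
have m0 : 0 < m by rewrite lt_min e0.
have me : m <= e by rewrite ge_min lexx.
have md : m <= d by rewrite ge_min lexx orbT.
suff : f (m / 2) < f 0.
  by apply/negP; rewrite -leNgt fmin// gtr0_norm; lra.
apply: (@ltr0_derive1_decr _ f 0 (m / 2)) => //; last by lra.
- move=> s; rewrite in_itv/= => /andP[s0 s1].
  by have [] : is_derive s 1 f (df s) by apply: fdf; rewrite gtr0_norm//; lra.
- move=> s; rewrite in_itv/= => /andP[s0 s1].
  have fs : is_derive s 1 f (df s) by apply: fdf; rewrite gtr0_norm//; lra.
  rewrite derive1E derive_val.
  have se : `|s| < e by rewrite gtr0_norm//; lra.
  have sN0 : s != 0 by rewrite gt_eqF.
  have := He s sN0 se; rewrite /GRing.scale /= mulr1 f'0 addr0 subr0.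
  by rewrite pmulr_rlt0 ?invr_gt0.
- apply: derivable_within_continuous => s.
  rewrite in_itv/= => /andP[s0 s1].
  by have [] : is_derive s 1 f (df s) by apply: fdf; rewrite ger0_norm//; lra.
Qed.

Lemma is_derive_line (V : normedModType R) (f : V -> R) (x v : V) (s : R) :
  derivable f (s *: v + x) v ->
  is_derive s 1 (fun r => f (r *: v + x)) ('D_v f (s *: v + x)).
Proof.
have E : (fun h : R => h^-1 *: (((fun r => f (r *: v + x)) \o shift s) h%:A
      - f (s *: v + x))) =
    (fun h : R => h^-1 *: ((f \o shift (s *: v + x)) (h *: v)
      - f (s *: v + x))).
  by apply/funext => h /=; rewrite [h%:A]mulr1 scalerDl addrA.
by move=> df; split; rewrite /derivable /derive E.
Qed.

(** Touching from below by a parabola, along the line through [x] directed by [v]: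
    the difference has a minimum at parameter 0. *)
Lemma second_partial_ge_of_touch (V : normedModType R) (f : V -> R) (x v : V)
    (b k d : R) : 0 < d ->
  (forall s : R, `|s| < d -> derivable f (s *: v + x) v) ->
  derivable ('D_v f) x v ->
  (forall s : R, `|s| < d -> f x + b * s - k * s ^+ 2 <= f (s *: v + x)) ->
  - (2 * k) <= 'D_v ('D_v f) x.
Proof.
move=> d0 df ddf fle.
have x0 : 0 *: v + x = x by rewrite scale0r add0r.
pose F s := f (s *: v + x) - b * s + k * s ^+ 2.
pose dF s := 'D_v f (s *: v + x) - b + 2 * k * s.
suff : 0 <= 'D_v ('D_v f) x + 2 * k by lra.
apply: (@second_derivative_at_min F dF _ d) => //.
- move=> s sd; have := is_derive_line (df s sd) => fs.
  apply: is_derive_eq; rewrite /GRing.scale/= /dF; ring.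
- have := @is_derive_line V ('D_v f) x v 0; rewrite x0 => /(_ ddf) => fs.
  by apply: is_derive_eq; rewrite /GRing.scale/=; ring.
- move=> s /fle; rewrite /F x0 mulr0 expr0n mulr0 subr0 addr0; lra.
Qed.

End touching.

(** * The nonlocal term *)
Section nonlocal_integral.
Context {R : realType} {n : nat}.
Implicit Types (U D V Omega : set 'rV[R]_n) (f v mu : 'rV[R]_n -> R).

Lemma ball_rVP (x y : 'rV[R]_n) (e : R) : 0 < e ->
  ball x e y <-> forall i, `|x ord0 i - y ord0 i| < e.
Proof.
move=> e0; split=> [[_ xy] i|xy]; first exact: xy.
by split=> // i j; rewrite ord1; exact: xy.
Qed.

(** The sigma-algebra is generated by the coordinates; an open set belongs to it
    as a countable union of boxes with rational centers and radii 1/(k+1). *)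
Lemma open_rV_measurable U : open U -> measurable U.
Proof.
move=> oU.
pose box (p : 'rV[rat]_n * nat) : set 'rV[R]_n := [set x | forall i,
  ratr (p.1 ord0 i) - p.2.+1%:R^-1 <= x ord0 i <=
  ratr (p.1 ord0 i) + p.2.+1%:R^-1].
pose good := [set p | box p `<=` U].
have -> : U = \bigcup_(p in good) box p.
  apply/seteqP; split=> [x Ux|x [p]]; last exact.
  have /nbhs_ballP[e /= e0 xe] : nbhs x U by move: oU; rewrite openE; apply.
  have [k] : exists k, 0 + k.+1%:R^-1 < e / 2 :> R.
    by apply: ltr_add_invr; lra.
  rewrite add0r => ke; set d : R := k.+1%:R^-1 in ke.
  have d0 : 0 < d by rewrite invr_gt0.
  have xq i : exists q : rat, ratr q \in `]x ord0 i - d, x ord0 i + d[.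
    by apply: rat_in_itvoo; lra.
  pose q : 'rV[rat]_n := \row_i xchoose (xq i).
  have qx i : x ord0 i - d < ratr (q ord0 i) < x ord0 i + d.
    by have := xchooseP (xq i); rewrite in_itv/= mxE.
  exists (q, k).
    move=> y /= yq; apply: xe; apply/ball_rVP => // i.
    have /andP[] := qx i; have /andP[] := yq i; rewrite -/d => *.
    by rewrite ltr_norml; apply/andP; split; lra.
  by move=> i /=; have /andP[] := qx i; rewrite -/d => *;
    apply/andP; split; lra.
rewrite bigcup_mkcond; apply: countable_bigcupT_measurable => //.
move=> p; case: ifPn => // _; exact: measurable_box.
Qed.

Lemma measurable_fun_open_continuous D f : open D ->
  (forall x, D x -> {for x, continuous f}) -> measurable_fun D f.
Proof.
move=> oD cf; apply: (measurability _ (measurable_realfun.RGenOpens.measurableE R)).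
move=> _ [_ [a [b ->] <-]]; apply: open_rV_measurable.
rewrite openE => x [Dx fx]; apply: filterI.
  by move: oD; rewrite openE; apply.
by apply: (cf x Dx); apply: open_nbhs_nbhs; split => //; exact: interval_open.
Qed.

Lemma open_translate Omega (x : 'rV[R]_n) : open Omega ->
  open [set z | Omega (x + z)].
Proof.
move=> oO; apply: (open_comp _ oO) => z _.
apply: continuousD; [exact: cst_continuous|exact: cvg_id].
Qed.

Lemma measurable_translate Omega (x : 'rV[R]_n) : open Omega ->
  measurable [set z | Omega (x + z)].
Proof. by move=> /(@open_translate _ x)/open_rV_measurable. Qed.

Section bounds.
Context (mu : 'rV[R]_n -> R) (Omega : set 'rV[R]_n).
Hypotheses (mu_L1 : (lebesgue_rV R n).-integrable [set: 'rV[R]_n] (EFin \o mu))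
  (mu_ge0 : forall z, 0 <= mu z) (Omega_open : open Omega).
Context (v : 'rV[R]_n -> R) (M : R).
Hypotheses (v_cont : forall x, Omega x -> {for x, continuous v})
  (v_le : forall x, Omega x -> `|v x| <= M).

Lemma integrable_on_measurable A : measurable A ->
  (lebesgue_rV R n).-integrable A (EFin \o mu).
Proof. by move=> mA; apply: integrableS mu_L1. Qed.

Lemma integrable_nonlocal (x : 'rV[R]_n) :
  (lebesgue_rV R n).-integrable [set z | Omega (x + z)]
    (EFin \o (fun z => v (x + z) * mu z)).
Proof.
have mA := measurable_translate x Omega_open.
have -> : EFin \o (fun z => v (x + z) * mu z) =
    ((EFin \o mu) \* (EFin \o (fun z => v (x + z))))%E.
  by apply/funext => z /=; rewrite mulrC.
apply: integrableMl => //; first exact: integrable_on_measurable.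
- apply: measurable_fun_open_continuous; first exact: open_translate.
  move=> z /= Oz; apply: (@continuous_comp _ _ _ (fun z => x + z) v).
    by apply: continuousD; [exact: cst_continuous|exact: cvg_id].
  exact: v_cont.
- exists M; split; first exact: num_real.
  by move=> N MN z /= Oz; exact: le_trans (v_le Oz) (ltW MN).
Qed.

Lemma subset_Rintegral (f : 'rV[R]_n -> R) A B :
  measurable A -> measurable B ->
  (lebesgue_rV R n).-integrable B (EFin \o f) -> (forall z, B z -> 0 <= f z) ->
  A `<=` B ->
  \int[lebesgue_rV R n]_(z in A) f z <= \int[lebesgue_rV R n]_(z in B) f z.
Proof.
move=> mA mB fB f0 AB; apply: fine_le.
- by apply: integrable_fin_num => //; exact: integrableS fB.
- exact: integrable_fin_num.
- apply: ge0_subset_integral => //; by case/integrableP: fB.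
Qed.

(** Only a part of the unit mass of [mu] is seen from [x]; as [m <= 0], that part
    times [m] is still at least [m]. *)
Lemma nonlocal_ge_neg (m : R) (x : 'rV[R]_n) :
  \int[lebesgue_rV R n]_z mu z = 1 -> m <= 0 ->
  (forall y, Omega y -> m <= v y) ->
  m <= \int[lebesgue_rV R n]_(z in [set z | Omega (x + z)]) (v (x + z) * mu z).
Proof.
move=> mu1 m0 mv; have mA := measurable_translate x Omega_open.
apply: (@le_trans _ _
  (\int[lebesgue_rV R n]_(z in [set z | Omega (x + z)]) (m * mu z))).
  rewrite RintegralZl//; last exact: integrable_on_measurable.
  rewrite -[leLHS]mulr1 ler_wnM2l// -[leRHS]mu1.
  exact: subset_Rintegral.
apply: le_Rintegral => //.
- by have := integrableZl mA m (integrable_on_measurable mA).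
- exact: integrable_nonlocal.
- by move=> z Oz; rewrite ler_wpM2r// mv.
Qed.

(** This turns positivity of [v] on the set [x + V] into positivity of the
    nonlocal term at [x]. *)
Lemma nonlocal_ge_mass (c : R) (x : 'rV[R]_n) (V : set 'rV[R]_n) :
  open V -> (forall y, Omega y -> 0 <= v y) ->
  (forall z, V z -> Omega (x + z) /\ c <= v (x + z)) ->
  c * fine (density_measure mu V) <=
  \int[lebesgue_rV R n]_(z in [set z | Omega (x + z)]) (v (x + z) * mu z).
Proof.
move=> oV v0 cv; have mA := measurable_translate x Omega_open.
have mV := open_rV_measurable oV.
have VO : V `<=` [set z | Omega (x + z)] by move=> z /cv[].
apply: (@le_trans _ _ (\int[lebesgue_rV R n]_(z in V) (v (x + z) * mu z))).
  rewrite -[fine _]/(\int[lebesgue_rV R n]_(z in V) mu z).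
  rewrite -RintegralZl//; last exact: integrable_on_measurable.
  apply: le_Rintegral => //.
  - by have := integrableZl mV c (integrable_on_measurable mV).
  - exact: integrableS (integrable_nonlocal x).
  - by move=> z /cv[Oz cz]; rewrite ler_wpM2r.
apply: subset_Rintegral => //; first exact: integrable_nonlocal.
by move=> z Oz; rewrite mulr_ge0// v0.
Qed.

End bounds.

Lemma density_measure_fin_num mu V :
  (lebesgue_rV R n).-integrable [set: 'rV[R]_n] (EFin \o mu) -> open V ->
  density_measure mu V \is a fin_num.
Proof.
move=> mu1 /open_rV_measurable mV; apply: integrable_fin_num => //.
exact: integrableS mu1.
Qed.

End nonlocal_integral.

(** * Functions on a space-time cylinder *)
Section cylinder.
Context {R : realType} {n : nat} (Omega : set 'rV[R]_n).
Implicit Types (u : 'rV[R]_n -> R -> R) (x y : 'rV[R]_n).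

Lemma slice_cvg u x t : continuous_cylinder Omega u -> closure Omega x ->
  0 <= t -> u y t @[y --> within Omega (nbhs x)] --> u x t.
Proof.
move=> /subspace_continuousP /(_ (x, t)) cu Ox t0.
have cut := cu (conj Ox t0).
have ct : (y, t) @[y --> x] --> (x, t).
  by apply: (@cvg_pair _ _ _ (nbhs x) (nbhs x) (nbhs t));
    [exact: cvg_id|exact: cvg_cst].
move=> P uP.
have HP : nbhs (x, t) [set p | (closure Omega `*` [set t : R | 0 <= t]) p ->
    P (u p.1 p.2)] := cut P uP.
apply: (@filterS _ (nbhs x) _ _ _ _ (ct _ HP)) => y /= HPy Oy; apply: HPy.
by split=> //=; exact: subset_closure.
Qed.

Hypothesis Omega_open : open Omega.

Lemma within_open x : Omega x -> within Omega (nbhs x) = nbhs x.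
Proof.
by move=> Ox; apply: within_interior; move: Omega_open; rewrite openE; apply.
Qed.

Lemma slice_continuous u x t : continuous_cylinder Omega u -> Omega x ->
  0 <= t -> {for x, continuous (u ^~ t)}.
Proof.
move=> cu Ox t0; have := slice_cvg cu (subset_closure Ox) t0.
by rewrite within_open.
Qed.

Lemma compact_closed_ball x (r : R) : compact (closed_ball x r).
Proof.
have [r0|r0] := ltP 0 r; last first.
  by rewrite closed_ball0//; exact: compact0.
apply: bounded_closed_compact; last exact: closed_ball_closed.
exists (`|x| + r); split; first exact: num_real.
move=> N MN y; rewrite closed_ballE// /closed_ball_ /= => xy.
apply: le_trans (ltW MN); rewrite -(subrK x y) addrC.
by apply: le_trans (ler_normD _ _) _; rewrite lerD2l distrC.
Qed.

Lemma compact_closure : bounded_set Omega -> compact (closure Omega).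
Proof.
move=> [M [Mr MO]].
have M0 : 0 < `|M| + 1 by rewrite ltr_wpDl.
apply: (@subclosed_compact _ _ (closed_ball (0 : 'rV[R]_n) (`|M| + 1))).
- exact: closed_closure.
- exact: compact_closed_ball.
have /closure_id -> : closed (closed_ball (0 : 'rV[R]_n) (`|M| + 1)).
  exact: closed_ball_closed.
apply: closure_subset => y Oy.
rewrite closed_ballE// /closed_ball_ /= sub0r normrN.
by apply: MO => //; rewrite (le_lt_trans (ler_norm M))// ltrDl.
Qed.

Lemma slice_bounded u t : bounded_set Omega -> continuous_cylinder Omega u ->
  0 <= t -> exists M, forall x, Omega x -> `|u x t| <= M.
Proof.
move=> bO cu t0.
have cK : compact (closure Omega `*` [set t]).
  by apply: compact_setX; [exact: compact_closure|exact: compact_set1].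
have : compact ((fun p : 'rV[R]_n * R => u p.1 p.2) @`
    (closure Omega `*` [set t])).
  apply: continuous_compact cK; apply: continuous_subspaceW cu.
  by move=> [y s] [/= Oy ->].
move=> /compact_bounded[M [Mr HM]]; exists (M + 1) => x Ox.
apply: (HM (M + 1)); first by rewrite ltrDl.
by exists (x, t) => //; split => //=; exact: subset_closure.
Qed.

(** The weight [expR (c * s)] absorbs the zeroth-order term of the equation, and
    [W] stands for a barrier. *)
Lemma cylinder_argmin u (K : set 'rV[R]_n) (c a b : R)
    (W : 'rV[R]_n -> R -> R) :
  continuous_cylinder Omega u -> compact K -> K !=set0 ->
  K `<=` closure Omega -> 0 <= a -> a <= b ->
  continuous (fun p : 'rV[R]_n * R => W p.1 p.2) ->
  exists y1 s1, [/\ K y1, a <= s1, s1 <= b &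
    forall y s, K y -> a <= s -> s <= b ->
      expR (c * s1) * u y1 s1 - W y1 s1 <= expR (c * s) * u y s - W y s].
Proof.
move=> cu cK [x0 Kx0] KO a0 ab cW.
pose F y s := expR (c * s) * u y s - W y s.
have cKI : compact (K `*` `[a, b]%classic).
  by apply: compact_setX => //; exact: segment_compact.
have K0 : K `*` `[a, b]%classic !=set0.
  by exists (x0, a); split => //=; rewrite in_itv/= lexx ab.
have cF : {within K `*` `[a, b]%classic,
    continuous (fun p : 'rV[R]_n * R => F p.1 p.2)}.
  have KIO : K `*` `[a, b]%classic `<=` closure Omega `*` [set t | 0 <= t].
    move=> [y s] [/= Ky]; rewrite in_itv/= => /andP[sa sb].
    by split; [exact: KO|exact: le_trans sa].
  have /subspace_continuousP cu' := continuous_subspaceW KIO cu.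
  apply/subspace_continuousP => p Kp; rewrite /F.
  apply: cvgB; last by
    apply: (@cvg_within_filter _ _ _ (nbhs p)); exact: (cW p).
  apply: cvgM; last exact: cu'.
  apply: (@cvg_within_filter _ _ _ (nbhs p)).
  apply: (@continuous_comp _ _ _ (fun p : 'rV[R]_n * R => c * p.2) expR).
    by apply: cvgM; [exact: cvg_cst|exact: cvg_snd].
  exact: continuous_expR.
have [[y1 s1]] := compact_EVT_min K0 cKI cF.
rewrite inE => -[/= Ky1]; rewrite in_itv/= => /andP[as1 s1b] Fmin.
exists y1, s1; split => // y s Ky sa sb.
by apply: (Fmin (y, s)); rewrite inE; split => //=; rewrite in_itv/= sa sb.
Qed.

(** The test function is a paraboloid with the gradient [b] and the Hessian
    [- 2 k Id] at [x]. *)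
Lemma laplacian_ge_of_touch u x t (b : 'I_n -> R) (k : R)
    (N : set 'rV[R]_n) :
  regular_cylinder Omega u -> 0 < t -> nbhs x N -> N `<=` Omega ->
  (forall y, N y -> u x t + \sum_i (b i * (y - x) ord0 i
      - k * (y - x) ord0 i ^+ 2) <= u y t) ->
  - (2 * k *+ n) <= laplacian (u ^~ t) x.
Proof.
move=> ru t0 xN NO ule.
have d2u y i : N y -> [/\ derivable (u ^~ t) y (Defs.basis i) &
    derivable (dpart i (u ^~ t)) y (Defs.basis i)].
  by move=> Ny; have [_ _ d2] := ru y t (NO _ Ny) t0; have [] := d2 i i.
have /nbhs_ballP[d /= d0 xd] := xN.
have Nx i (s : R) : `|s| < d -> N (s *: Defs.basis i + x).
  move=> sd; apply: xd; apply/ball_rVP => // j.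
  rewrite !mxE opprD addrCA subrr addr0 normrN normrM.
  rewrite eqxx /=; case: (j == i); rewrite ?normr1 ?mulr1// normr0 mulr0//.
rewrite /laplacian -[in leLHS](card_ord n) -sumr_const -sumrN.
apply: ler_sum => i _.
apply: (@second_partial_ge_of_touch _ _ _ _ _ (b i) k d) => [//|s sd||s sd].
- by have [du _] := d2u _ i (Nx i s sd); exact: du.
- by have [_ ddu] := d2u _ i (nbhs_singleton xN); exact: ddu.
apply: le_trans (ule _ (Nx i s sd)).
have E : s *: Defs.basis i + x - x = s *: (Defs.basis i : 'rV[R]_n).
  exact: addrK.
rewrite -addrA lerD2l (bigD1 i)//= E !mxE !eqxx mulr1 big1 ?addr0//.
by move=> j ji; rewrite !mxE eqxx (negPf ji)/= !mulr0 expr0n mulr0 subr0.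
Qed.

End cylinder.

(** * Minimum principles for the viscous problem *)
Section comparison.
Context {R : realType} {n : nat} (Omega : set 'rV[R]_n) (mu u0 : 'rV[R]_n -> R).
Hypotheses (Omega_open : open Omega) (Omega_bounded : bounded_set Omega)
  (mu_L1 : (lebesgue_rV R n).-integrable [set: 'rV[R]_n] (EFin \o mu))
  (mu_ge0 : forall z, 0 <= mu z)
  (mu_mass1 : \int[lebesgue_rV R n]_z mu z = 1)
  (u0_ge0 : forall x, Omega x -> 0 <= u0 x).
Context (eps : R) (w : 'rV[R]_n -> R -> R).
Hypotheses (eps_gt0 : 0 < eps) (wP : viscous_solution Omega mu u0 eps w).

(** At a negative minimum of exp(-s) w, the time derivative of w is at most w,
    hence negative; but there Delta w >= 0 and, as [mu] has mass 1, the nonlocal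
    operator is nonnegative too. *)
Lemma viscous_ge0 x t : Omega x -> 0 <= t -> 0 <= w x t.
Proof.
move=> Ox t0; rewrite leNgt; apply/negP => wlt0.
have [cw rw eqw w0 wi] := wP.
have c0 : continuous ((fun=> 0) : 'rV[R]_n * R -> R).
  by move=> p; exact: cvg_cst.
have [y1 [s1 []]] := @cylinder_argmin _ _ Omega w _ (-1) 0 t (fun _ _ => 0)
  cw (compact_closure Omega_bounded)
  (ex_intro _ x (subset_closure Ox)) (fun y Oy => Oy) (lexx 0) t0
  c0.
move=> Oy1 s10 s1t wmin.
set m := expR (-1 * s1) * w y1 s1.
have mle y s : closure Omega y -> 0 <= s -> s <= t -> m * expR s <= w y s.
  move=> Oy s0 st; have := wmin y s Oy s0 st; rewrite !subr0 -/m.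
  by rewrite mulN1r expRN mulrC ler_pdivlMr ?expR_gt0.
have wE : w y1 s1 = m * expR s1.
  by rewrite /m mulrAC mulN1r expRN mulVf ?mul1r// gt_eqF ?expR_gt0.
have m0 : m < 0.
  have := mle x t (subset_closure Ox) t0 (lexx t).
  by move=> /le_lt_trans/(_ wlt0); rewrite pmulr_llt0 ?expR_gt0.
have w1 : w y1 s1 < 0 by rewrite wE pmulr_llt0 ?expR_gt0.
have s1_gt0 : 0 < s1.
  rewrite lt_neqAle s10 andbT; apply/eqP => s1E.
  have PF : ProperFilter (within Omega (nbhs y1)) by exact: within_nbhs_proper.
  have := slice_cvg cw Oy1 s10; rewrite -s1E => wy1.
  move: w1; apply/negP; rewrite -leNgt -s1E; apply: cvgr_to_ge wy1 _.
  rewrite near_withinE; near=> y => Oy; rewrite wi//; exact: u0_ge0.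
have Oy1' : Omega y1.
  apply: contrapT => NO; move: w1; rewrite w0 ?ltxx//; split => //.
  by move=> /interior_subset.
have [dw _ d2w] := rw y1 s1 Oy1' s1_gt0.
have dw1 : derive1 (w y1) s1 <= m * expR s1.
  apply: (@derive1_le_of_touch_left _ (w y1) (fun s => m * expR s) s1 _ s1) => //.
  by move=> s; rewrite subrr => s0 ss; apply: mle => //; [exact: ltW|
    exact: le_trans (ltW ss) s1t].
have lap0 : 0 <= laplacian (w ^~ s1) y1.
  rewrite (_ : 0 = - (2 * 0 *+ n)); last by rewrite mulr0 mul0rn oppr0.
  apply: (laplacian_ge_of_touch (b := fun=> 0) rw s1_gt0
    (open_nbhs_nbhs (conj Omega_open Oy1')) (fun _ => id)) => y Oy.
  rewrite big1 ?addr0; last by move=> i _; rewrite !mul0r subr0.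
  by rewrite wE; apply: mle => //; exact: subset_closure.
have [M wM] := slice_bounded Omega_bounded cw s10.
have K0ge : 0 <= K0 Omega mu w y1 s1.
  rewrite subr_ge0; apply: (@nonlocal_ge_neg _ _ mu Omega _ _ _ (w ^~ s1) M) => //.
  - by move=> y Oy; exact: (slice_continuous Omega_open cw Oy s10).
  - exact: ltW.
  - by move=> y Oy; rewrite wE; apply: mle => //; exact: subset_closure.
have := eqw y1 s1 Oy1' s1_gt0.
have : 0 <= eps * laplacian (w ^~ s1) y1 by rewrite mulr_ge0// ltW.
rewrite -wE in dw1; lra.
Unshelve. all: by end_near. Qed.

(** Comparison with the barrier exp(s0-s) W, where
    W(y,s) = (al + ga (s-s0)) (1 - |y-x|^2/r^2) - L (s-s0) and |.| is the
    Euclidean norm.  On the boundary of the cube |y-x| >= r, so W <= 0 there.  The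
    concave factor costs at most 2 n eps C / r^2 in W_t - eps Delta W, where C is the
    largest value of al + ga (s-s0); the constant 2 n + 1 in L makes the
    inequality W_t - eps Delta W < ga strict, which excludes an interior
    minimum of exp(s) w - exp(s0) W at which this difference is negative. *)
Lemma viscous_center_lower_bound x (r s0 T al ga : R) :
  0 < r -> closed_ball x r `<=` Omega -> 0 <= s0 -> s0 <= T -> 0 <= al ->
  0 <= ga -> 0 < al + ga * (T - s0) ->
  (forall y, closed_ball x r y -> al <= w y s0) ->
  (forall y s, closed_ball x r y -> s0 < s -> s <= T ->
    ga <= \int[lebesgue_rV R n]_(z in [set z | Omega (y + z)])
      (w (y + z) s * mu z)) ->
  forall s, s0 <= s -> s <= T ->
  expR (s0 - s) * (al + ga * (s - s0)
    - (2 * n%:R + 1) * eps * (al + ga * (T - s0)) / r ^+ 2 * (s - s0))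
  <= w x s.
Proof.
move=> r0 xrO s00 s0T al0 ga0; set C := al + ga * (T - s0) => C0 wal wga s s0s sT.
have [cw rw eqw wb wi] := wP.
pose N2 : R := 2 * n%:R + 1.
pose L := N2 * eps * C / r ^+ 2.
pose q (y : 'rV[R]_n) := \sum_i (y - x) ord0 i ^+ 2.
pose A s := al + ga * (s - s0).
pose W (y : 'rV[R]_n) (s : R) := A s * (1 - q y / r ^+ 2) - L * (s - s0).
have r20 : 0 < r ^+ 2 by rewrite exprn_gt0.
have q0 y : 0 <= q y by apply: sumr_ge0 => i _; rewrite sqr_ge0.
have N20 : 0 < N2 by rewrite ltr_wpDl// mulr_ge0.
have L0 : 0 < L by rewrite !mulr_gt0// invr_gt0.
have cx i : continuous (fun p : 'rV[R]_n * R => (p.1 - x) ord0 i).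
  have -> : (fun p : 'rV[R]_n * R => (p.1 - x) ord0 i) =
      (fun p => p.1 ord0 i - x ord0 i) by apply/funext => p; rewrite !mxE.
  move=> p; apply: cvgB; last exact: cvg_cst.
  apply: (@continuous_comp _ _ _ fst (fun y : 'rV[R]_n => y ord0 i)).
    exact: cvg_fst.
  exact: coord_continuous.
have cq : continuous (fun p : 'rV[R]_n * R => q p.1).
  move=> p; apply: cvg_big => [|i _]; first exact: add_continuous.
  apply: (@cvgM _ _ _ _ (fun p : 'rV[R]_n * R => (p.1 - x) ord0 i)
    (fun p : 'rV[R]_n * R => (p.1 - x) ord0 i)).
    exact: cx.
  exact: cx.
have cA : continuous (fun p : 'rV[R]_n * R => p.2 - s0).
  by move=> p; apply: cvgB; [exact: cvg_snd|exact: cvg_cst].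
have cW : continuous (fun p : 'rV[R]_n * R => expR s0 * W p.1 p.2).
  move=> p; apply: cvgM; first exact: cvg_cst.
  apply: cvgB; last by apply: cvgM; [exact: cvg_cst|exact: cA].
  apply: cvgM.
    by apply: cvgD; [exact: cvg_cst|apply: cvgM; [exact: cvg_cst|exact: cA]].
  apply: cvgB; first exact: cvg_cst.
  by apply: cvgM; [exact: cq|exact: cvg_cst].
have xx : closed_ball x r x by exact: closed_ballxx.
have [y1 [s1 [xy1 s0s1 s1T]]] := @cylinder_argmin _ _ Omega w _ 1 s0 T
  (fun y s => expR s0 * W y s) cw (@compact_closed_ball _ _ x r)
  (ex_intro _ x xx) (fun y xy => subset_closure (xrO y xy)) s00 s0T cW.
set m := expR (1 * s1) * w y1 s1 - expR s0 * W y1 s1 => Fmin.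
have wle y t : closed_ball x r y -> s0 <= t -> t <= T ->
    expR (s0 - t) * W y t + m * expR (- t) <= w y t.
  move=> xy s0t tT; have := Fmin y t xy s0t tT.
  rewrite -/m mul1r => h.
  rewrite expRD expRN mulrAC -mulrDl ler_pdivrMr ?expR_gt0//; lra.
have wE : w y1 s1 = expR (s0 - s1) * W y1 s1 + m * expR (- s1).
  rewrite /m mul1r expRD expRN mulrBl.
  by rewrite [_ * w _ _]mulrC mulfK ?gt_eqF ?expR_gt0//; ring.
have s10 : 0 <= s1 by exact: le_trans s0s1.
suff m0 : 0 <= m.
  have := wle x s xx s0s sT; apply: le_trans.
  have -> : W x s = al + ga * (s - s0) - L * (s - s0).
    rewrite /W /q big1 ?mul0r ?subr0 ?mulr1// => i _.
    by rewrite subrr mxE expr0n.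
  by rewrite lerDl mulr_ge0// expR_ge0.
rewrite leNgt; apply/negP => m0.
have w1 : 0 <= w y1 s1 by apply: viscous_ge0 => //; exact: xrO.
have em : m * expR (- s1) < 0 by rewrite pmulr_llt0 ?expR_gt0.
have A0 : 0 <= A s1 by rewrite addr_ge0// mulr_ge0// subr_ge0.
have AC : A s1 <= C by rewrite lerD2l ler_wpM2l// lerD2r.
set e := expR (s0 - s1) in wE.
have e0 : 0 < e by exact: expR_gt0.
have e1 : e <= 1 by rewrite -expR0 ler_expR subr_le0.
have W1 : 0 < W y1 s1.
  by rewrite -(pmulr_rgt0 _ e0); lra.
(* Otherwise some coordinate of y1 - x is at least r in modulus, so W y1 s1 <= 0. *)
have xy1' : ball x r y1.
  apply: contrapT => xy; have /existsNP[i /negP xi] :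
    ~ forall i, `|x ord0 i - y1 ord0 i| < r by move=> /(ball_rVP _ _ r0).
  move: W1; apply/negP; rewrite -leNgt /W subr_le0.
  apply: (@le_trans _ _ 0); last by rewrite mulr_ge0 ?subr_ge0// ltW.
  rewrite mulr_ge0_le0// subr_le0 ler_pdivlMr// mul1r.
  rewrite /q (bigD1 i)//= ler_wpDr ?sumr_ge0// => [j _|]; first exact: sqr_ge0.
  rewrite !mxE -[leRHS]real_normK ?num_real// distrC.
  by rewrite lerXn2r ?nnegrE ?(ltW r0)// leNgt.
have s0s1' : s0 < s1.
  rewrite lt_neqAle s0s1 andbT; apply/eqP => s01.
  have := wal y1 xy1; rewrite s01 wE /e -s01 subrr expR0 mul1r /W /A subrr !mulr0.
  rewrite addr0 subr0 mulrBr mulr1 => h.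
  have : 0 <= al * (q y1 / r ^+ 2) by rewrite !mulr_ge0// invr_ge0 ltW.
  by rewrite -s01 in em; lra.
have s1_gt0 : 0 < s1 by exact: le_lt_trans s0s1'.
have Oy1 := xrO _ xy1.
have dw : derive1 (w y1) s1 <= - w y1 s1 + e * (ga * (1 - q y1 / r ^+ 2) - L).
  have [dw _ _] := rw y1 s1 Oy1 s1_gt0.
  apply: (@derive1_le_of_touch_left _ (w y1)
    (fun s => expR (s0 - s) * W y1 s + m * expR (- s)) s1 _ (s1 - s0)) => [| |//| |].
  - by rewrite subr_gt0.
  - exact: dw.
  - rewrite /W /A; apply: is_derive_eq; rewrite /GRing.scale/= wE /W /A -/e; ring.
  - exact: wE.
  - rewrite opprB addrC subrK => t /ltW s0t /ltW ts1.
    by apply: wle => //; exact: le_trans s1T.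
pose k := e * A s1 / r ^+ 2.
have lap : - (2 * k *+ n) <= laplacian (w ^~ s1) y1.
  apply: (@laplacian_ge_of_touch _ _ Omega w y1 s1
    (fun i => - (2 * (y1 - x) ord0 i * k)) k (ball x r)) => //.
  - by apply: open_nbhs_nbhs; split => //; exact: ball_open.
  - by move=> y /subset_closed_ball/xrO.
  move=> y xy; have := wle y s1 (subset_closed_ball xy) s0s1 s1T.
  apply: le_trans; rewrite wE -/e.
  have -> : \sum_i (- (2 * (y1 - x) ord0 i * k) * (y - y1) ord0 i
      - k * (y - y1) ord0 i ^+ 2) = - k * (q y - q y1).
    rewrite /q -sumrB mulr_sumr; apply: eq_bigr => i _; rewrite !mxE; ring.
  rewrite /W /k le_eqVlt; apply/orP; left; apply/eqP; ring.
have := eqw y1 s1 Oy1 s1_gt0; rewrite /K0.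
have := wga y1 s1 xy1 s0s1' s1T.
set I := \int[_]_(_ in _) _ => Iga eqI.
pose E := e * eps / r ^+ 2.
have E0 : 0 < E by rewrite !mulr_gt0// invr_gt0.
have eL : e * L = E * (2 * n%:R * C) + E * C by rewrite /L /E /N2; ring.
have epsk : eps * (2 * k *+ n) = E * (2 * n%:R * A s1).
  by rewrite /E /k -mulr_natr; ring.
have EC : 0 < E * C by rewrite mulr_gt0.
have EAC : E * (2 * n%:R * A s1) <= E * (2 * n%:R * C).
  by rewrite ler_wpM2l ?(ltW E0)// ler_wpM2l// mulr_ge0.
have lap' : - (eps * (2 * k *+ n)) <= eps * laplacian (w ^~ s1) y1.
  by rewrite -mulrN ler_wpM2l// ltW.
have ega : e * ga * (1 - q y1 / r ^+ 2) <= ga.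
  rewrite mulrBr mulr1; apply: (@le_trans _ _ (e * ga)).
    by rewrite gerBl !mulr_ge0// ?invr_ge0 ltW.
  by rewrite ler_piMl.
rewrite mulrBr mulrA in dw; lra.
Qed.

End comparison.

(** * Bounds at a center, uniform in the radius *)
Section uniform_bound.
Context {R : realType} {n : nat} (Omega : set 'rV[R]_n) (mu u0 : 'rV[R]_n -> R).
Hypotheses (Omega_open : open Omega) (Omega_bounded : bounded_set Omega)
  (mu_L1 : (lebesgue_rV R n).-integrable [set: 'rV[R]_n] (EFin \o mu))
  (mu_ge0 : forall z, 0 <= mu z)
  (mu_mass1 : \int[lebesgue_rV R n]_z mu z = 1)
  (u0_ge0 : forall x, Omega x -> 0 <= u0 x).

(** Below this viscosity, the loss caused by the curvature of the barrier in a
    cube of half-side [r] is at most half of its value up to time [T]. *)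
Definition viscosity_threshold (r T : R) := r ^+ 2 / (2 * (2 * n%:R + 1) * T).

Lemma viscosity_threshold_gt0 r T : 0 < r -> 0 < T ->
  0 < viscosity_threshold r T.
Proof.
by move=> r0 T0; rewrite divr_gt0 ?exprn_gt0// !mulr_gt0.
Qed.

(** The radius enters only through the threshold on [eps], not through the bound;
    this is what allows [r] to shrink as the center approaches the boundary. *)
Lemma viscous_center_uniform_bound eps w x (r s0 T al ga : R) :
  0 < eps -> viscous_solution Omega mu u0 eps w ->
  0 < r -> closed_ball x r `<=` Omega -> 0 <= s0 -> s0 < T -> 0 <= al ->
  0 <= ga -> 0 < al + ga -> eps <= viscosity_threshold r T ->
  (forall y, closed_ball x r y -> al <= w y s0) ->
  (forall y s, closed_ball x r y -> s0 < s -> s <= T ->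
    ga <= \int[lebesgue_rV R n]_(z in [set z | Omega (y + z)])
      (w (y + z) s * mu z)) ->
  forall s, s0 <= s -> s <= T ->
  expR (- T) * ((al + ga * (s - s0)) / 2) <= w x s.
Proof.
move=> eps0 wP r0 xr s00 s0T al0 ga0 alga epsr wal wga s s0s sT.
have C0 : 0 < al + ga * (T - s0).
  have d0 : 0 < T - s0 by rewrite subr_gt0.
  have [ga00|ga_gt0] := eqVneq ga 0; last first.
    by rewrite ltr_wpDl// mulr_gt0// lt_neqAle eq_sym ga_gt0.
  by move: alga; rewrite ga00 mul0r.
apply: le_trans (viscous_center_lower_bound Omega_open Omega_bounded mu_L1
  mu_ge0 mu_mass1 u0_ge0 eps0 wP r0 xr s00 (ltW s0T) al0 ga0 C0 wal wga s0s sT).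
have T0 : 0 < T by exact: le_lt_trans s0T.
pose K := (2 * n%:R + 1) * eps / r ^+ 2.
have N0 : 0 < 2 * n%:R + 1 :> R by rewrite ltr_wpDl// mulr_ge0.
have r20 : 0 < r ^+ 2 by rewrite exprn_gt0.
have K0 : 0 <= K by rewrite !mulr_ge0 ?invr_ge0 ?ltW.
have KT : K * T <= 2^-1.
  move: epsr; rewrite /viscosity_threshold ler_pdivlMr ?mulr_gt0// => h.
  by rewrite /K mulrAC ler_pdivrMr//; lra.
pose d := s - s0; have d0 : 0 <= d by rewrite subr_ge0.
have -> : (2 * n%:R + 1) * eps * (al + ga * (T - s0)) / r ^+ 2 * (s - s0) =
    al * (K * d) + ga * d * (K * (T - s0)) by rewrite /K /d; ring.
have Kd : K * d <= 2^-1.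
  by apply: le_trans KT; rewrite ler_wpM2l// /d lerBlDr ler_wpDr.
have KT' : K * (T - s0) <= 2^-1.
  by apply: le_trans KT; rewrite ler_wpM2l// gerBl.
have h1 : al * (K * d) <= al * 2^-1 by rewrite ler_wpM2l.
have h2 : ga * d * (K * (T - s0)) <= ga * d * 2^-1.
  by rewrite ler_wpM2l// mulr_ge0.
have gd : 0 <= ga * d by rewrite mulr_ge0.
apply: ler_pM; rewrite ?expR_ge0//.
- by rewrite divr_ge0// addr_ge0.
- by rewrite ler_expR lerNl opprB lerBlDr ler_wpDr.
- by rewrite -/d; lra.
Qed.

End uniform_bound.

(** * Spreading of positivity *)
Section propagation.
Context {R : realType} {n : nat} (Omega : set 'rV[R]_n) (mu u0 : 'rV[R]_n -> R).
Hypotheses (Omega_open : open Omega) (Omega_bounded : bounded_set Omega)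
  (mu_L1 : (lebesgue_rV R n).-integrable [set: 'rV[R]_n] (EFin \o mu))
  (mu_ge0 : forall z, 0 <= mu z)
  (mu_mass1 : \int[lebesgue_rV R n]_z mu z = 1)
  (u0_ge0 : forall x, Omega x -> 0 <= u0 x).
Context (u_ : R -> 'rV[R]_n -> R -> R).
Hypothesis (u_solution : forall eps, 0 < eps ->
  viscous_solution Omega mu u0 eps (u_ eps)).
Context (T : R).
Hypothesis (T_gt0 : 0 < T).

(** The bound is required from any positive time [s0] on, because spreading to a
    neighbor consumes a little time: to obtain it from [s0] at the neighbor, it is
    used from [s0 / 2] at [p]. *)
Definition uniformly_positive_at (p : 'rV[R]_n) := forall s0, 0 < s0 -> s0 < T ->
  exists rho c eps0, [/\ 0 < rho, 0 < c, 0 < eps0, ball p rho `<=` Omega &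
    forall eps y s, 0 < eps -> eps < eps0 -> ball p rho y -> s0 <= s -> s <= T ->
      c <= u_ eps y s].

Lemma open_ball_subset x : Omega x -> exists2 d, 0 < d & ball x d `<=` Omega.
Proof.
move=> Ox; have /nbhs_ballP[d d0 xd] : nbhs x Omega by exact: open_nbhs_nbhs.
by exists d.
Qed.

Lemma closed_ball_sub_ball (x y : 'rV[R]_n) (d e : R) : 0 < e ->
  ball x d y -> closed_ball y e `<=` ball x (d + e).
Proof.
move=> e0 xy z; rewrite closed_ballE// /closed_ball_ /= => yz.
move: xy; rewrite -!ball_normE /= => xy.
have -> : x - z = (x - y) + (y - z) by rewrite addrA subrK.
by apply: le_lt_trans (ler_normD _ _) _; exact: ltr_leD.
Qed.

Lemma uniformly_positive_at_initial p : Omega p ->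
  {for p, continuous u0} -> 0 < u0 p -> uniformly_positive_at p.
Proof.
move=> Op cu0 u0p s0 s00 s0T.
have [d1 d10 pO] := open_ball_subset Op.
have u0p2 : u0 p / 2 < u0 p by lra.
have /nbhs_ballP[d2 /= d20 pu0] : nbhs p [set y | u0 p / 2 < u0 y].
  exact: (cvgr_gt _ cu0 _ u0p2).
pose d := Num.min d1 d2 / 2.
have m0 : 0 < Num.min d1 d2 by rewrite lt_min d10.
have d0 : 0 < d by rewrite divr_gt0.
have dd : d + d = Num.min d1 d2 by rewrite /d; lra.
have dd1 : ball p (d + d) `<=` ball p d1.
  by apply: le_ball; rewrite dd ge_min lexx.
have dd2 : ball p (d + d) `<=` ball p d2.
  by apply: le_ball; rewrite dd ge_min lexx orbT.
exists d, (expR (- T) * ((u0 p / 2) / 2)), (viscosity_threshold (n := n) d T).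
split => //.
- by rewrite mulr_gt0 ?expR_gt0// !divr_gt0.
- exact: viscosity_threshold_gt0.
- by apply: subset_trans pO; apply: le_ball;
    rewrite (@le_trans _ _ (d + d)) ?dd ?ge_min ?lexx// -dd lerDl ltW.
move=> eps y s eps0 epsd py s0s sT.
have yd := closed_ball_sub_ball d0 py.
have yO : closed_ball y d `<=` Omega by move=> z /yd/dd1/pO.
have [_ _ _ _ wi] := u_solution eps0.
rewrite (_ : u0 p / 2 = u0 p / 2 + 0 * (s - 0)); last by rewrite mul0r addr0.
apply: (viscous_center_uniform_bound Omega_open Omega_bounded mu_L1 mu_ge0
  mu_mass1 u0_ge0 eps0 (u_solution eps0) d0) => //.
- by rewrite ltW// divr_gt0.
- by rewrite addr0 divr_gt0.
- exact: ltW.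
- by move=> z yz; rewrite wi; [exact/ltW/pu0/dd2/yd|exact: yO].
- move=> z t yz t0 tT; apply: Rintegral_ge0 => z' Oz' /=.
  rewrite mulr_ge0//; apply: (viscous_ge0 Omega_open Omega_bounded mu_L1
    mu_ge0 mu_mass1 u0_ge0 eps0 (u_solution eps0)) => //; exact: ltW.
- exact: le_trans (ltW s00) s0s.
Qed.

(** Here [x] may lie on the boundary of [Omega].  The constant [c] does not depend
    on the radius [r] of the cube available around [y]; the threshold on the
    viscosity does. *)
Lemma uniformly_positive_spread p x s0 :
  measure_support (density_measure mu) (p - x) -> uniformly_positive_at p ->
  0 < s0 -> s0 < T ->
  exists rho c, [/\ 0 < rho, 0 < c & forall r, 0 < r ->
    exists2 eps0, 0 < eps0 & forall eps y s, 0 < eps -> eps < eps0 ->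
      closed_ball y r `<=` Omega `&` ball x rho -> s0 <= s -> s <= T ->
      c <= u_ eps y s].
Proof.
move=> supp pP s00 s0T.
have s02 : 0 < s0 / 2 by rewrite divr_gt0.
have s02T : s0 / 2 < T by lra.
have [rho [c [eps1 [rho0 c0 eps10 pO uc]]]] := pP (s0 / 2) s02 s02T.
have rho2 : 0 < rho / 2 by rewrite divr_gt0.
(* For y near x, y + V is contained in the ball where u_ eps >= c. *)
pose V := ball (p - x) (rho / 2).
have oV : open V by exact: ball_open.
have mV : 0 < fine (density_measure mu V).
  rewrite fine_gt0//; apply/andP; split.
    by apply: supp => //; exact: ballxx.
  by have := density_measure_fin_num mu_L1 oV; rewrite fin_numE => /andP[_];
    rewrite ltey.
have Vp y z : ball x (rho / 2) y -> V z -> ball p rho (y + z).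
  rewrite /V -!ball_normE /= => xy zV.
  have -> : p - (y + z) = (x - y) + (p - x - z).
    by rewrite [RHS]addrC !addrA [_ - z + x]addrAC subrK opprD addrA addrAC.
  rewrite [rho]splitr; apply: le_lt_trans (ler_normD _ _) _.
  exact: ltrD.
pose ga := c * fine (density_measure mu V).
have ga0 : 0 < ga by rewrite mulr_gt0.
exists (rho / 2), (expR (- T) * ((ga * (s0 / 2)) / 2)).
split => //; first by rewrite !mulr_gt0 ?expR_gt0// invr_gt0.
move=> r r0; exists (Num.min eps1 (viscosity_threshold (n := n) r T)).
  by rewrite lt_min eps10 viscosity_threshold_gt0.
move=> eps y s eps0; rewrite lt_min => /andP[epse1 epsr] yr s0s sT.
have wP := u_solution eps0.
have cw : continuous_cylinder Omega (u_ eps) by case: wP.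
have w0 := viscous_ge0 Omega_open Omega_bounded mu_L1 mu_ge0 mu_mass1 u0_ge0
  eps0 wP.
apply: (@le_trans _ _ (expR (- T) * ((0 + ga * (s - s0 / 2)) / 2))).
  rewrite add0r ler_wpM2l ?expR_ge0// ler_wpM2r// ler_wpM2l//; first exact: ltW.
  by rewrite lerBrDr -splitr.
apply: (viscous_center_uniform_bound Omega_open Omega_bounded mu_L1 mu_ge0
  mu_mass1 u0_ge0 eps0 wP r0) => //.
- by move=> z /yr[].
- exact: ltW.
- exact: ltW.
- by rewrite add0r.
- exact: ltW.
- by move=> z /yr[Oz _]; apply: w0 => //; exact: ltW.
- move=> z t /yr[Oz xz] s0t tT.
  have t0 : 0 <= t by apply: ltW; exact: lt_trans s0t.
  have [M wM] := slice_bounded Omega_bounded cw t0.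
  apply: (@nonlocal_ge_mass _ _ mu Omega mu_L1 mu_ge0 Omega_open
    ((u_ eps) ^~ t) M _ wM c z V oV).
  + by move=> y' Oy'; exact: (slice_continuous Omega_open cw Oy' t0).
  + by move=> y' Oy'; exact: w0.
  + move=> z' Vz'; have pz := Vp z z' xz Vz'; split; first exact: pO.
    by apply: uc => //; exact: ltW.
- by apply: le_trans s0s; lra.
Qed.

Lemma uniformly_positive_at_spread p x : Omega x ->
  measure_support (density_measure mu) (p - x) -> uniformly_positive_at p ->
  uniformly_positive_at x.
Proof.
move=> Ox supp pP s0 s00 s0T.
have [rho [c [rho0 c0 H]]] := uniformly_positive_spread supp pP s00 s0T.
have [d1 d10 xO] := open_ball_subset Ox.
pose d := Num.min d1 rho / 2.
have m0 : 0 < Num.min d1 rho by rewrite lt_min d10.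
have d0 : 0 < d by rewrite divr_gt0.
have dd : d + d = Num.min d1 rho by rewrite /d; lra.
have dd1 : ball x (d + d) `<=` ball x d1.
  by apply: le_ball; rewrite dd ge_min lexx.
have dd2 : ball x (d + d) `<=` ball x rho.
  by apply: le_ball; rewrite dd ge_min lexx orbT.
have [eps0 eps00 Heps] := H d d0.
exists d, c, eps0; split => //.
  by apply: subset_trans xO; apply: subset_trans dd1; apply: le_ball;
    rewrite lerDl ltW.
move=> eps y s eps1 epslt xy s0s sT; apply: Heps => // z.
by move=> /(closed_ball_sub_ball d0 xy) xz; split; [exact/xO/dd1|exact: dd2].
Qed.

(** Positivity spreads over the fixed distance [delta], hence to every point of
    [Omega] in the closure of the set of uniformly positive points. *)
Lemma uniformly_positive_everywhere (delta : R) : 0 < delta -> connected Omega ->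
  (forall z, ball 0 delta z -> measure_support (density_measure mu) z) ->
  (exists2 p, Omega p & uniformly_positive_at p) ->
  forall x, Omega x -> uniformly_positive_at x.
Proof.
move=> delta0 cO supp [p Op pP].
pose G := [set x | Omega x /\ uniformly_positive_at x].
have near_supp (x q : 'rV[R]_n) : ball x delta q ->
    measure_support (density_measure mu) (q - x).
  rewrite -ball_normE /= => xq; apply: supp.
  by rewrite -ball_normE /= sub0r normrN distrC.
have clG x : Omega x -> closure G x -> uniformly_positive_at x.
  move=> Ox /(_ (ball x delta)) []; first exact: nbhsx_ballx.
  move=> q [[Oq qP] xq].
  exact: uniformly_positive_at_spread (near_supp _ _ xq) qP.
have oG : open G.
  rewrite openE => q [Oq qP]; have [d d0 qd] := open_ball_subset Oq.
  apply/nbhs_ballP; exists (Num.min d delta) => /=; first by rewrite lt_min d0.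
  move=> y qy.
  have Oy : Omega y by apply: qd; apply: le_ball qy; rewrite ge_min lexx.
  have yq : ball y delta q.
    by apply: ball_sym; apply: le_ball qy; rewrite ge_min lexx orbT.
  by split => //; exact: uniformly_positive_at_spread (near_supp _ _ yq) qP.
have GE : G = Omega.
  apply: cO; first by exists p.
  - by exists G => //; apply/seteqP; split => [y [Oy yP]|y []].
  - exists (closure G); first exact: closed_closure.
    apply/seteqP; split => [y Gy|y [Oy]/(clG _ Oy) yP]; last by [].
    by split; [case: Gy|exact: subset_closure].
by move=> x; rewrite -GE => -[].
Qed.

End propagation.

(** The sum of the squares is at most n (eta/(n+1))^2; the crude divisor n+1
    is never zero and keeps square roots out of the estimate. *)
Lemma enorm_le_of_coord (R : realType) (n : nat) (z : 'rV[R]_n) (eta : R) :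
  0 < eta -> (forall i, `|z ord0 i| <= eta / n.+1%:R) -> enorm z <= eta.
Proof.
move=> eta0 zi; rewrite /enorm -[leRHS](ger0_norm (ltW eta0)) -sqrtr_sqr.
have n0 : 0 < n.+1%:R :> R by [].
rewrite ler_sqrt ?sqr_ge0//.
apply: (@le_trans _ _ (\sum_(i < n) (eta / n.+1%:R) ^+ 2)).
  apply: ler_sum => i _; rewrite -[leLHS]real_normK ?num_real//.
  by rewrite lerXn2r ?nnegrE// ltW// divr_gt0.
rewrite sumr_const card_ord -[leLHS]mulr_natr expr_div_n [leLHS]mulrAC.
rewrite ler_pdivrMr ?exprn_gt0//.
rewrite ler_wpM2l ?sqr_ge0// expr2 -[leLHS]mulr1.
by apply: ler_pM => //; rewrite ?ler_nat// ler1n.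
Qed.

(** * Strict positivity on the boundary *)
Theorem corollary6p1 (R : realType) (n : nat) (n_gt0 : (0 < n)%N)
  (Omega : set 'rV[R]_n)
  (Omega_open : open Omega) (Omega_bounded : bounded_set Omega)
  (Omega_connected : connected Omega) (Omega_smooth : smooth_boundary Omega)
  (mu : 'rV[R]_n -> R)
  (mu_L1 : (lebesgue_rV R n).-integrable [set: 'rV[R]_n] (EFin \o mu))
  (mu_ge0 : forall z, 0 <= mu z)
  (mu_mass1 : \int[lebesgue_rV R n]_z mu z = 1)
  (eta : R) (eta_gt0 : 0 < eta)
  (mu_support : [set z | enorm z <= eta] `<=`
    measure_support (density_measure mu))
  (u0 : 'rV[R]_n -> R)
  (u0_continuous : forall x, Omega x -> {for x, continuous u0})
  (u0_ge0 : forall x, Omega x -> 0 <= u0 x)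
  (u0_neq0 : exists2 x, Omega x & u0 x != 0)
  (u0_compact : compact (closure [set x | Omega x /\ u0 x != 0]))
  (u0_supp : closure [set x | Omega x /\ u0 x != 0] `<=` Omega)
  (u_ : R -> 'rV[R]_n -> R -> R)
  (u_solution : forall eps, 0 < eps ->
    viscous_solution Omega mu u0 eps (u_ eps))
  (u : 'rV[R]_n -> R -> R)
  (u_continuous : continuous_cylinder Omega u)
  (u_limit : forall x t, Omega x -> 0 < t ->
    u_ eps x t @[eps --> 0^'+] --> u x t) :
  forall x t, boundary Omega x -> 0 < t -> 0 < u x t.
Proof.
move=> x t [Ox _] t0.
pose delta := eta / n.+1%:R.
have delta0 : 0 < delta by rewrite divr_gt0.
have supp (z : 'rV[R]_n) : ball 0 delta z ->
    measure_support (density_measure mu) z.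
  move=> /(ball_rVP _ _ delta0) zd; apply: mu_support => /=.
  apply: enorm_le_of_coord => // i.
  by have := zd i; rewrite mxE sub0r normrN => /ltW.
have initial : exists2 p, Omega p & uniformly_positive_at Omega u_ t p.
  have [p Op up] := u0_neq0; exists p => //.
  apply: (uniformly_positive_at_initial Omega_open Omega_bounded mu_L1 mu_ge0
    mu_mass1 u0_ge0 u_solution t0 Op (u0_continuous _ Op)).
  by rewrite lt_neqAle eq_sym up u0_ge0.
have everywhere := uniformly_positive_everywhere Omega_open Omega_bounded mu_L1
  mu_ge0 mu_mass1 u0_ge0 u_solution t0 delta0 Omega_connected supp initial.
have [p [Op xp]] := Ox (ball x delta) (nbhsx_ballx _ _ delta0).
have supp_px : measure_support (density_measure mu) (p - x).
  by apply: supp; move: xp; rewrite -!ball_normE /= sub0r normrN distrC.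
have t20 : 0 < t / 2 by rewrite divr_gt0.
have t2t : t / 2 < t by lra.
have [rho [c [rho0 c0 uc]]] := uniformly_positive_spread Omega_open Omega_bounded
  mu_L1 mu_ge0 mu_mass1 u0_ge0 u_solution t0 supp_px (everywhere p Op) t20 t2t.
have interior_bound y : Omega y -> ball x rho y -> c <= u y t.
  move=> Oy xy.
  have : nbhs y (Omega `&` ball x rho).
    by apply: open_nbhs_nbhs; split => //; apply: openI => //; exact: ball_open.
  move=> /nbhs_closedballP[r yr].
  have [eps0 eps00 ueps] := uc r%:num [gt0 of r%:num].
  apply: (cvgr_to_ge (u_limit y t Oy t0)).
  near=> eps; apply: (ueps eps y t) => //.
  exact: ltW.
(* First eps tends to 0 at fixed y, which gave [interior_bound]; now y tends to x. *)
apply: (lt_le_trans c0).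
have PF : ProperFilter (within Omega (nbhs x)) by exact: within_nbhs_proper.
apply: (cvgr_to_ge (slice_cvg u_continuous Ox (ltW t0))).
rewrite near_withinE; near=> y => Oy; apply: interior_bound => //.
near: y; exact: nbhsx_ballx.
Unshelve. all: by end_near. Qed.
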